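(* Let $N,B\ge 1$ be integers. A set $\mathcal{K}$ is a periodic sparse ruler of length $NB-1$ and period $N$ if and only if there exists a sparse ruler $\mathcal{M}$ of length $N-1$ such that $$\mathcal{K}=\{m+bN:\ m\in\mathcal{M},\ b=0,1,\ldots,B-1\}.$$
   Context: The difference set of $\mathcal{A}\subset\mathbb{Z}$ is $\Delta(\mathcal{A})=\{\delta\ge 0:\ \exists a_1,a_2\in\mathcal{A}\text{ such that }\delta=a_2-a_1\}$. A length-$(L-1)$ (linear) sparse ruler is a set $\mathcal{K}\subset\{0,1,\ldots,L-1\}$ satisfying $\Delta(\mathcal{K})=\{0,1,\ldots,L-1\}$. A length-$(L-1)$ periodic sparse ruler of period $N$, where $N$ divides $L$, is a set $\mathcal{K}\subset\{0,1,\ldots,L-1\}$ satisfying: (1) if $k\in\mathcal{K}$, then $k+bN\in\mathcal{K}$ for all $b\in\mathbb{Z}$ such that $0\le k+bN<L$; (2) $\Delta(\mathcal{K})=\{0,1,\ldots,L-1\}$. *)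

(* Defs.v *)
From mathcomp Require Import all_boot all_order all_algebra.
From mathcomp Require Import classical_sets.

Set Implicit Arguments.
Unset Strict Implicit.
Unset Printing Implicit Defensive.

Import Order.TTheory GRing.Theory Num.Theory.

Local Open Scope classical_set_scope.
Local Open Scope ring_scope.

Definition difference_set (A : set int) : set int :=
  [set d | 0 <= d /\ exists a1 a2 : int, [/\ A a1, A a2 & d = a2 - a1]].

(* Rulers are indexed by their length [len], an integer, so that the length
   L - 1 is never truncated; the marks {0, ..., L - 1} are {0, ..., len}. *)
Definition marks (len : int) : set int := [set k | 0 <= k <= len].

Definition sparse_ruler (len : int) (K : set int) : Prop :=
  K `<=` marks len /\ difference_set K = marks len.

(* Here L = len + 1, which the period [N] must divide. *)
Definition periodic_sparse_ruler (len N : int) (K : set int) : Prop :=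
  [/\ (N %| len + 1)%Z,
      K `<=` marks len,
      forall k b : int, K k -> 0 <= k + b * N < len + 1 -> K (k + b * N)
    & difference_set K = marks len].

(* Main.v *)
(** The restriction [M] of [K] to [{0, ..., N - 1}] inherits every difference
    [d < N] from the difference [d + (B - 1) * N] of [K]: writing the latter as
    [(m2 + b2 * N) - (m1 + b1 * N)] with [b2 - b1 <= B - 1] and [m2 - m1 < N]
    forces [b2 - b1 = B - 1] and [m2 - m1 = d].  Conversely, if
    [d = r + q * N] with [0 <= r < N] and [r = m2 - m1] in [M], then [d] is
    the difference of the marks [m2 + q * N] and [m1] of [K]. *)
Require Import Defs.
From mathcomp Require Import all_boot all_order all_algebra.
From mathcomp Require Import classical_sets.
From mathcomp Require Import zify.

Import Order.TTheory GRing.Theory Num.Theory.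

Local Open Scope classical_set_scope.
Local Open Scope ring_scope.

(** Two marks between [0] and [len] differ by at most [len], so one of the two inclusions is
    automatic. *)
Lemma difference_set_marksP (len : int) (K : set int) :
  K `<=` marks len ->
  difference_set K = marks len <-> marks len `<=` difference_set K.
Proof.
move=> Kmarks; split=> [-> //|marksK]; apply/seteqP; split=> // d.
by case=> d_ge0 [a1 [a2 [/Kmarks + /Kmarks + d_def]]]; rewrite /marks /=; lia.
Qed.

Lemma marks_divz (N B k : int) : 1 <= N -> marks (N * B - 1) k ->
  exists r q : int, [/\ marks (N - 1) r, 0 <= q <= B - 1 & k = r + q * N].
Proof.
move=> N_ge1; rewrite /marks /= => k_bound.
have r_lt : (k %% N)%Z < N by apply: ltz_pmod; lia.
have r_ge0 : 0 <= (k %% N)%Z by apply: modz_ge0; lia.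
have kE := divz_eq k N.
by exists (k %% N)%Z, (k %/ N)%Z; split; nia.
Qed.

(** Since [0 <= m < N], the point [m + b * N] lies in the [b]-th block of length [N], and each block
    is either inside [[0, N * B)] or disjoint from it. *)
Lemma marks_add_mul (N B m b : int) : 1 <= N -> marks (N - 1) m ->
  marks (N * B - 1) (m + b * N) <-> 0 <= b <= B - 1.
Proof. by move=> N_ge1; rewrite /marks /= => m_bound; split=> ?; nia. Qed.

Lemma periodic_sparse_ruler_restrict (N B : int) (K : set int) :
  1 <= N -> 1 <= B -> periodic_sparse_ruler (N * B - 1) N K ->
  sparse_ruler (N - 1) (K `&` marks (N - 1)) /\
  K = [set k | exists m b : int,
    [/\ (K `&` marks (N - 1)) m, 0 <= b <= B - 1 & k = m + b * N]].
Proof.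
move=> N_ge1 B_ge1 [_ Kmarks Kper Kdiff].
have Kshift k b : K k -> marks (N * B - 1) (k + b * N) -> K (k + b * N).
  by move=> Kk; rewrite /marks /= => kb; apply: Kper => //; lia.
have Kdecomp k : K k -> exists m b : int,
    [/\ (K `&` marks (N - 1)) m, 0 <= b <= B - 1 & k = m + b * N].
  move=> Kk; have [r [q [rM qB kE]]] := marks_divz _ _ _ N_ge1 (Kmarks k Kk).
  exists r, q; split=> //; split=> //.
  (* Periodicity also permits negative shifts, so moving [k] back by [q] periods shows that its
     residue is in [K]. *)
  have rE : r = k + - q * N by lia.
  by rewrite rE; apply: Kshift => //; rewrite -rE; move: rM; rewrite /marks /=; nia.
split; last first.
  apply/seteqP; split=> k; first exact: Kdecomp.
  by case=> m [b [[Km mM] bB ->]]; apply: Kshift => //; apply/marks_add_mul.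
split; first by move=> k [].
apply/difference_set_marksP => [k []//|d dM].
have : marks (N * B - 1) (d + (B - 1) * N) by apply/marks_add_mul => //; lia.
rewrite -Kdiff => -[_ [a1 [a2 [/Kdecomp + /Kdecomp]]]].
move=> [m1 [b1 [M1 b1B ->]]] [m2 [b2 [M2 b2B ->]]] dE.
move: dM M1.2 M2.2; rewrite /marks /= => d_bound m1_bound m2_bound.
have dE' : d + (B - 1 - (b2 - b1)) * N = m2 - m1 by lia.
(* This integer is nonnegative because [b2 <= B - 1] and [0 <= b1]; if it were at least 1, [dE']
   would give [m2 - m1 >= N]. *)
have c_eq0 : B - 1 - (b2 - b1) = 0 by nia.
split; first by lia.
by exists m1, m2; split=> //; rewrite -dE' c_eq0 mul0r addr0.
Qed.

Lemma periodic_sparse_ruler_extend (N B : int) (M : set int) :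
  1 <= N -> 1 <= B -> sparse_ruler (N - 1) M ->
  periodic_sparse_ruler (N * B - 1) N
    [set k | exists m b : int, [/\ M m, 0 <= b <= B - 1 & k = m + b * N]].
Proof.
move=> N_ge1 B_ge1 [Mmarks Mdiff]; set K := [set k | _].
have Kmarks : K `<=` marks (N * B - 1).
  by move=> _ [m [b [/Mmarks mM bB ->]]]; apply/marks_add_mul.
split=> //; first by rewrite subrK dvdz_mulr.
  move=> _ b [m [c [Mm cB ->]]] bound; exists m, (c + b).
  split=> //; last by rewrite mulrDl addrA.
  (* The shifted point is still a mark, which bounds its block index [c + b]. *)
  apply/(marks_add_mul N B m) => //; first exact: Mmarks.
  by rewrite /marks /=; lia.
apply/difference_set_marksP => // d dM.
have [r [q [+ qB dE]]] := marks_divz _ _ _ N_ge1 dM.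
rewrite -Mdiff => -[_ [m1 [m2 [M1 M2 rE]]]].
split; first by move: dM; rewrite /marks /=; lia.
exists m1, (m2 + q * N); split; last by lia.
(* Block 0 is available because [1 <= B]. *)
- by exists m1, 0; split=> //; lia.
- by exists m2, q.
Qed.

Theorem theorem4 (N B : int) (hN : 1 <= N) (hB : 1 <= B) (K : set int) :
  periodic_sparse_ruler (N * B - 1) N K <->
  exists M : set int,
    sparse_ruler (N - 1) M /\
    K = [set k | exists m b : int, [/\ M m, 0 <= b <= B - 1 & k = m + b * N]].
Proof.
split=> [Kper|[M [Mruler ->]]]; last exact: periodic_sparse_ruler_extend.
by exists (K `&` marks (N - 1)); apply: periodic_sparse_ruler_restrict.
Qed.
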